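(* Let $\mathcal{H}$ be a complex Hilbert space, let $T \in B(\mathcal{H})$, and let $N(\cdot)$ be an algebra norm on $B(\mathcal{H})$. Then $$w_N(T) \geq \frac12 \max\left\{ \sqrt{N(|T|^2 + |T^*|^2)},\ \sqrt{N(T^2 + T^{*2})} \right\}.$$
   Context: $B(\mathcal{H})$ is the $C^*$-algebra of bounded linear operators on the complex Hilbert space $\mathcal{H}$. For $T \in B(\mathcal{H})$, $T^*$ is the adjoint, $T^{*2} = (T^* )^2$, $|T| = (T^*T)^{1/2}$, $|T^*| = (TT^* )^{1/2}$, and $\Re(T) = \frac12(T + T^* )$. A norm $N(\cdot)$ on $B(\mathcal{H})$ (as a complex vector space) is an algebra norm if $N(TS) \leq N(T)N(S)$ for all $T, S \in B(\mathcal{H})$. The generalized numerical radius is $w_N(T) = \sup_{\theta \in \mathbb{R}} N(\Re(e^{i\theta}T))$. *)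

(* Defs.v *)
From HB Require Import structures.
From mathcomp Require Import all_boot all_order all_algebra.
From mathcomp Require Import complex.
From mathcomp Require Import boolp classical_sets functions reals trigo.
From mathcomp Require Import topology normedtype.

Set Implicit Arguments.
Unset Strict Implicit.
Unset Printing Implicit Defensive.

Import Order.TTheory GRing.Theory Num.Theory.
Import numFieldNormedType.Exports.

Local Open Scope classical_set_scope.
Local Open Scope ring_scope.
Local Open Scope complex_scope.

(* Norms on a module over R[i] take their values in R[i] (on the nonnegative
   real axis). The inner product is linear in its first argument and
   conjugate-linear in its second one. *)
HB.mixin Record CompleteNormedModule_isHilbert (R : realType) H
    & CompleteNormedModule R[i] H := {
  inner : {dot H for (@Num.conj R[i])} ;
  inner_normE : forall x : H, inner x x = `|x| ^+ 2
}.

#[short(type="hilbertType")]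
HB.structure Definition Hilbert (R : realType) :=
  {H of CompleteNormedModule_isHilbert R H & CompleteNormedModule R[i] H}.

Section BoundedOperators.
Context {R : realType} {H : hilbertType R}.

Definition bounded_op : {pred H -> H} := mem
  [set f : H -> H | linear f /\ exists M : R, forall x, `|f x| <= M%:C * `|x|].

Lemma bounded_opP (f : H -> H) : reflect
  (linear f /\ exists M : R, forall x, `|f x| <= M%:C * `|x|)
  (f \in bounded_op).
Proof. by apply: (iffP idP); rewrite inE. Qed.

Record bop := Bop {bop_fun :> H -> H; _ : bop_fun \in bounded_op}.

HB.instance Definition _ := [isSub for bop_fun].
HB.instance Definition _ := [Choice of bop by <:].

Lemma bopP (T : bop) : bop_fun T \in bounded_op.
Proof. exact: (valP T). Qed.

Lemma bop_linear (T : bop) : linear T.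
Proof. by case/bounded_opP: (bopP T). Qed.

HB.instance Definition _ (T : bop) :=
  GRing.isLinear.Build R[i] H H _ (bop_fun T) (bop_linear T).

Lemma bop_eqP (S T : bop) : S =1 T <-> S = T.
Proof. by split=> [ST|->//]; apply: val_inj; apply/funext. Qed.

Fact bounded_op_submod_closed : submod_closed bounded_op.
Proof.
split=> [|a f g /bounded_opP[lf [M fM]] /bounded_opP[lg [P gP]]].
  apply/bounded_opP; split=> [a x y|]; first by rewrite /= scaler0 addr0.
  by exists 0 => x; rewrite normr0 mul0r.
apply/bounded_opP; split=> [b x y|].
  by rewrite !fctE lf lg !scalerDr !scalerA mulrC addrACA.
exists (ComplexField.Normc.normc a * M + P) => x; rewrite !fctE.
rewrite (le_trans (ler_normD _ _))// rmorphD rmorphM/= mulrDl lerD//.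
by rewrite normrZ -mulrA ler_wpM2l.
Qed.

HB.instance Definition _ :=
  GRing.isSubmodClosed.Build _ _ bounded_op bounded_op_submod_closed.
HB.instance Definition _ := [SubChoice_isSubLmodule of bop by <:].

Fact bounded_op_id : id \in bounded_op.
Proof. by apply/bounded_opP; split=> //; exists 1 => x; rewrite mul1r. Qed.

Fact bounded_op_comp (S T : bop) : S \o T \in bounded_op.
Proof.
case/bounded_opP: (bopP S) => lS [M SM]; case/bounded_opP: (bopP T) => lT [P TP].
apply/bounded_opP; split=> [a x y|]; first by rewrite /= lT lS.
exists (`|M| * P) => x /=; rewrite rmorphM/= (le_trans (SM _))// -mulrA.
apply: (@le_trans _ _ (`|M|%:C * `|T x|)).
  by rewrite ler_wpM2r// lecR ler_norm.
by rewrite ler_wpM2l// ler0c.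
Qed.

Definition bop_one := Bop bounded_op_id.
Definition bop_mul (S T : bop) := Bop (bounded_op_comp S T).

Fact bop_mulA : associative bop_mul.
Proof. by move=> S T U; apply/bop_eqP. Qed.
Fact bop_mul1 : left_id bop_one bop_mul.
Proof. by move=> T; apply/bop_eqP. Qed.
Fact bop_mulr1 : right_id bop_one bop_mul.
Proof. by move=> T; apply/bop_eqP. Qed.
Fact bop_mulDl : left_distributive bop_mul +%R.
Proof. by move=> S T U; apply/bop_eqP. Qed.
Fact bop_mulDr : right_distributive bop_mul +%R.
Proof. by move=> S T U; apply/bop_eqP => x; exact: (raddfD S). Qed.

HB.instance Definition _ := GRing.Zmodule_isPzRing.Build bop
  bop_mulA bop_mul1 bop_mulr1 bop_mulDl bop_mulDr.

(* The default value 0 is never used: adjoints exist (and are unique) because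
   H is complete. *)
Definition adjoint (T : bop) : bop :=
  xget 0 [set S : bop | forall x y, inner (T x) y = inner x (S y)].

(* 0 <= z in R[i] means that z is real and nonnegative. *)
Definition positive_op (A : bop) := forall x, 0 <= inner (A x) x.

(* As for adjoint, the default value 0 is not used when A is positive: A then
   has a unique positive square root. *)
Definition sqrt_op (A : bop) : bop :=
  xget 0 [set B | positive_op B /\ B ^+ 2 = A].

Definition abs_op (T : bop) : bop := sqrt_op (adjoint T * T).

Definition re_op (T : bop) : bop := 2^-1 *: (T + adjoint T).

Record algebra_norm (N : bop -> R) : Prop := {
  algebra_norm_ge0 : forall T, 0 <= N T ;
  algebra_norm_eq0 : forall T, N T = 0 -> T = 0 ;
  algebra_normZ : forall (a : R[i]) T,
    N (a *: T) = ComplexField.Normc.normc a * N T ;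
  algebra_normD : forall S T, N (S + T) <= N S + N T ;
  algebra_normM : forall S T, N (S * T) <= N S * N T }.

Definition expi (theta : R) : R[i] := cos theta +i* sin theta.

(* The set is bounded above by (N T + N (adjoint T)) / 2 when N is a norm, so
   that sup is the genuine supremum. *)
Definition gen_numradius (N : bop -> R) (T : bop) : R :=
  sup [set N (re_op (expi theta *: T)) | theta in [set: R]].

End BoundedOperators.

Arguments bop {R} H.

(* Main.v *)
Require Import Defs.
From mathcomp Require Import all_boot all_order all_algebra complex reals.
From mathcomp Require Import boolp classical_sets trigo.

(** Put [S := adjoint T] and [w := gen_numradius N T].  The angles [0] and
    [pi / 2] in the supremum defining [w] give
      [N (T + S) <= 2 * w]   and   [N (T - S) <= 2 * w]
    ([gen_numradius_addadj] and [gen_numradius_subadj]); these are twice the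
    norms of the real and imaginary parts of [T].  The two operators of the
    theorem are means of squares of these:
      [2 * (S * T + T * S) = (T + S)^2 - (T - S)^2],
      [2 * (T^2 + S^2)     = (T + S)^2 + (T - S)^2],
    so submultiplicativity bounds the norm of each of them by [(2 * w)^2], and
    it remains to take square roots.

    Both [adjoint] and [sqrt_op] select an operator with a given property, and
    take the value [0] when there is none; each step holds in either case.  The
    rules [adjointZ] and [adjoint_adjointM] are true of genuine adjoints and of
    the default alike, since having an adjoint is invariant under multiplication
    by nonzero scalars.  By [sqrt_op_sqr] the operator [abs_op T ^+ 2] is [S * T]
    or [0], and [abs_op S ^+ 2] is [T * S] or [0].  If neither is a default, their
    sum is the operator treated above; otherwise it is [S * T], [T * S] or [0],
    and its norm is at most [N S * N T <= (2 * w)^2], because [T] and [S] are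
    themselves means of [T + S] and of [T - S] or its opposite. *)

Set Implicit Arguments.
Unset Strict Implicit.
Unset Printing Implicit Defensive.

Import Order.TTheory GRing.Theory Num.Theory ComplexField.

Local Open Scope classical_set_scope.
Local Open Scope ring_scope.

Section Adjoint.
Context {R : realType} {H : hilbertType R}.
Implicit Types (S T A : bop H) (a : R[i]).

(** That [S] is the adjoint of [T], independently of the choice made by
    [adjoint]. *)
Definition adjoint_pair T S := forall x y, inner (T x) y = inner x (S y).

Lemma inner_inj (u v : H) : (forall x, inner x u = inner x v) -> u = v.
Proof.
move=> uv; apply/eqP; rewrite -subr_eq0 -normr_eq0 -sqrf_eq0 -inner_normE.
by rewrite linearBr subr_eq0; apply/eqP; exact: uv.
Qed.

Lemma adjoint_pairE T S : adjoint_pair T S -> adjoint T = S.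
Proof.
move=> TS; apply: xget_unique => // S' TS'.
by apply/bop_eqP => y; apply: inner_inj => x; rewrite -TS -TS'.
Qed.

Lemma adjoint_pair_sym T S : adjoint_pair T S -> adjoint_pair S T.
Proof.
move=> TS x y; rewrite [LHS]hermC [RHS]hermC.
by congr (_ * _^*); apply: esym; apply: TS.
Qed.

Lemma adjoint_pairZ a T S :
  adjoint_pair T S -> adjoint_pair (a *: T) (a^* *: S).
Proof.
move=> TS x y.
have -> : (a *: T) x = a *: T x by [].
have -> : (a^* *: S) y = a^* *: S y by [].
rewrite linearZl_LR linearZr_LR /= conjCK.
by congr (_ * _); exact: TS.
Qed.

(** For nonzero [a], the operator [a *: T] has an adjoint if and only if [T]
    has one, so either both choices are genuine adjoints or both are [0]. *)
Lemma adjointZ a T : adjoint (a *: T) = a^* *: adjoint T.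
Proof.
have [->|a0] := eqVneq a 0.
  rewrite conjC0 !scale0r; apply: adjoint_pairE => x y.
  by rewrite linear0l linear0r.
have [[S TS]|noT] := pselect (exists S, adjoint_pair T S).
  by rewrite (adjoint_pairE TS); apply/adjoint_pairE/adjoint_pairZ.
rewrite /adjoint !xgetPN ?scaler0 // => S TS; apply: noT; first by exists S.
exists ((a^-1)^* *: S); have := adjoint_pairZ a^-1 TS.
by rewrite scalerA mulVf// scale1r.
Qed.

(** A substitute for [adjoint (adjoint T) = T] that survives the default value:
    if [T] had no adjoint, then [adjoint T = 0] would annihilate both sides. *)
Lemma adjoint_adjointM T : adjoint (adjoint T) * adjoint T = T * adjoint T.
Proof.
have [[S TS]|noT] := pselect (exists S, adjoint_pair T S).
  by rewrite (adjoint_pairE TS) (adjoint_pairE (adjoint_pair_sym TS)).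
have -> : adjoint T = 0.
  by apply: xgetPN => S TS; apply: noT; exists S.
by rewrite !mulr0.
Qed.

Lemma sqrt_op_sqr A : sqrt_op A ^+ 2 = A \/ sqrt_op A ^+ 2 = 0.
Proof.
rewrite /sqrt_op; case: xgetP => [B _ [_ ?]|_]; first by left.
by right; rewrite expr2 mul0r.
Qed.

End Adjoint.

Section ComplexModulus.
Context {R : realType}.

Lemma normc_expi (t : R) : Normc.normc (expi t) = 1.
Proof. by rewrite /= cos2Dsin2 sqrtr1. Qed.

Lemma normc_conj (a : R[i]) : Normc.normc a^* = Normc.normc a.
Proof. by case: a => x y /=; rewrite sqrrN. Qed.

End ComplexModulus.

Section AlgebraNorm.
Context {R : realType} {H : hilbertType R} {N : bop H -> R}.
Hypothesis hN : algebra_norm N.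
Implicit Types (T X Y Z : bop H) (t : R).

Lemma algebra_norm0 : N 0 = 0.
Proof. by rewrite -(scale0r 0) (algebra_normZ hN) Normc.normc0 mul0r. Qed.

Lemma algebra_normN X : N (- X) = N X.
Proof. by rewrite -scaleN1r (algebra_normZ hN) normcN Normc.normc1 mul1r. Qed.

Lemma algebra_normMn X n : N (X *+ n) = N X *+ n.
Proof.
rewrite -scaler_nat (algebra_normZ hN) normcMn Normc.normc1.
by rewrite mulr_natl.
Qed.

Lemma algebra_normM_le X Y (r : R) : N X <= r -> N Y <= r -> N (X * Y) <= r ^+ 2.
Proof.
move=> Xr Yr; rewrite expr2 (le_trans (algebra_normM hN _ _))//.
by rewrite ler_pM ?(algebra_norm_ge0 hN).
Qed.

(** The mean [X] of [Y] and [Z] is specified by an equation without division,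
    so that it can be verified by ring identities. *)
Lemma algebra_norm_mean X Y Z (r : R) :
  N Y <= r -> N Z <= r -> X *+ 2 = Y + Z -> N X <= r.
Proof.
move=> Yr Zr XE; rewrite -(ler_pMn2r (isT : (0 < 2)%N)) -algebra_normMn XE.
by rewrite (le_trans (algebra_normD hN _ _))// mulr2n lerD.
Qed.

(** The left-hand side is twice [re_op (expi t *: T)].  The supremum dominates
    its members because the triangle inequality bounds them all by
    [N T + N (adjoint T)], the phases having modulus [1]. *)
Lemma gen_numradius_ubound T t :
  N (expi t *: T + (expi t)^* *: adjoint T) <= gen_numradius N T *+ 2.
Proof.
have reE s : N (re_op (expi s *: T)) *+ 2 =
    N (expi s *: T + (expi s)^* *: adjoint T).
  rewrite -algebra_normMn /re_op adjointZ -scaler_nat scalerA.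
  by rewrite divff ?pnatr_eq0 ?scale1r.
rewrite -reE lerMn2r /=; apply: sup_upper_bound; last by exists t.
split; first by exists (N (re_op (expi 0 *: T))), 0.
exists (N T + N (adjoint T)) => _ [s _ <-].
have n0 := algebra_norm_ge0 hN (re_op (expi s *: T)).
apply: (@le_trans _ _ (N (re_op (expi s *: T)) *+ 2)).
  by rewrite mulr2n lerDl.
rewrite reE (le_trans (algebra_normD hN _ _))// !(algebra_normZ hN).
by rewrite normc_conj normc_expi !mul1r.
Qed.

Lemma gen_numradius_addadj T : N (T + adjoint T) <= gen_numradius N T *+ 2.
Proof.
have := gen_numradius_ubound T 0.
by rewrite /expi cos0 sin0 -/(1%:C)%C conjC1 !scale1r.
Qed.

Lemma gen_numradius_subadj T : N (T - adjoint T) <= gen_numradius N T *+ 2.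
Proof.
have := gen_numradius_ubound T (pi / 2).
have -> : (expi (pi / 2) : R[i])^* = - expi (pi / 2).
  by rewrite /expi cos_pihalf; apply/eqP; rewrite eq_complex /= oppr0 !eqxx.
by rewrite scaleNr -scalerBr (algebra_normZ hN) normc_expi mul1r.
Qed.

End AlgebraNorm.

Theorem theorem4 (R : realType) (H : hilbertType R) (T : bop H)
    (N : bop H -> R) (hN : algebra_norm N) :
  gen_numradius N T >=
  2^-1 * Num.max (Num.sqrt (N (abs_op T ^+ 2 + abs_op (adjoint T) ^+ 2)))
                 (Num.sqrt (N (T ^+ 2 + adjoint T ^+ 2))).
Proof.
have := gen_numradius_addadj hN T; have := gen_numradius_subadj hN T.
set S := adjoint T; set r := gen_numradius N T *+ 2 => Br Ar.
have r0 : 0 <= r by apply: le_trans Ar; exact: algebra_norm_ge0.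
have Tr : N T <= r.
  by apply: (algebra_norm_mean hN Ar Br); rewrite addrACA subrr addr0.
have Sr : N S <= r.
  apply: (algebra_norm_mean hN Ar (Z := - (T - S))).
    by rewrite (algebra_normN hN).
  by rewrite opprB addrC subrKA.
have A2r : N ((T + S) ^+ 2) <= r ^+ 2 by exact: (algebra_normM_le hN Ar Ar).
have B2r : N ((T - S) ^+ 2) <= r ^+ 2 by exact: (algebra_normM_le hN Br Br).
have sqrDE : (T + S) ^+ 2 = (T ^+ 2 + S ^+ 2) + (T * S + S * T).
  by rewrite !expr2 mulrDl !mulrDr [S * T + _]addrC addrACA.
have sqrBE : (T - S) ^+ 2 = (T ^+ 2 + S ^+ 2) - (T * S + S * T).
  by rewrite !expr2 mulrBl !mulrBr opprB opprD addrACA.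
have sqrt_le X : N X <= r ^+ 2 -> Num.sqrt (N X) <= r.
  by move=> Xr; rewrite -[leRHS](ger0_norm r0) -sqrtr_sqr ler_sqrt ?sqr_ge0.
suff : Num.max (Num.sqrt (N (abs_op T ^+ 2 + abs_op S ^+ 2)))
               (Num.sqrt (N (T ^+ 2 + S ^+ 2))) <= r.
  by rewrite mulrC ler_pdivrMr ?ltr0n// mulr_natr.
rewrite ge_max !sqrt_le//.
  apply: (algebra_norm_mean hN A2r B2r).
  by rewrite sqrDE sqrBE addrACA subrr addr0.
rewrite /abs_op -/S [adjoint S * S]adjoint_adjointM -/S.
have [->|->] := sqrt_op_sqr (S * T); have [->|->] := sqrt_op_sqr (T * S).
- apply: (algebra_norm_mean hN A2r (Z := - (T - S) ^+ 2)).
    by rewrite (algebra_normN hN).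
  by rewrite sqrDE sqrBE opprB [in RHS]addrC subrKA [S * T + _]addrC.
- by rewrite addr0 (algebra_normM_le hN).
- by rewrite add0r (algebra_normM_le hN).
- by rewrite addr0 algebra_norm0 ?sqr_ge0.
Qed.
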